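(* For every $n\ge 1$, the $n\times n$ minor (the determinant) of an $n\times n$ symmetric matrix of indeterminates forms a tropical basis; i.e., a real symmetric $n\times n$ matrix $A$ is symmetrically tropically singular if and only if $A$ has a singular symmetric lift.
   Context: Let $\tilde K$ be the field of Hahn series $\sum_{\alpha\in A}c_\alpha t^\alpha$ ($A\subset\mathbb R$ well-ordered, $c_\alpha\in\mathbb C$); for nonzero $a\in\tilde K$, $\deg(a)$ is the smallest exponent with nonzero coefficient. A symmetric lift of a real symmetric $n\times n$ matrix $A$ is a symmetric matrix $\tilde A$ over $\tilde K$ with all entries nonzero and $\deg(\tilde a_{i,j})=A_{i,j}$. $A$ is symmetrically tropically singular if, among the monomials $\prod_i X_{i,\sigma(i)}$ ($\sigma\in S_n$) in commuting variables subject to $X_{i,j}=X_{j,i}$, with value $\sum_i A_{i,\sigma(i)}$, the minimum value is attained by at least two distinct monomials. The minors form a tropical basis means the tropical prevariety of their tropicalizations equals the tropicalization (image under coordinatewise $\deg$) of the variety they define in nonzero coordinates. *)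

(* Defs.v *)
From HB Require Import structures.
From mathcomp Require Import all_boot all_order all_algebra.
From mathcomp Require Import fingroup perm.
From mathcomp Require Import boolp classical_sets functions cardinality fsbigop.
From mathcomp Require Import reals Rstruct.
From mathcomp Require Import complex.

Set Implicit Arguments.
Unset Strict Implicit.
Unset Printing Implicit Defensive.

Import Order.TTheory GRing.Theory Num.Theory.
Local Open Scope classical_set_scope.
Local Open Scope ring_scope.

Notation RR := Rdefinitions.R.
Notation CC := (complex RR).

(** A (formal) Hahn series sum_{alpha in A} c_alpha t^alpha is represented by
    its coefficient function  c : RR -> CC ;  it is a Hahn series iff its
    support is well-ordered. *)
Definition support_hahn (c : RR -> CC) : set RR := [set a | c a != 0].

Definition well_ordered (S : set RR) : Prop :=
  forall B : set RR, B `<=` S -> B !=set0 ->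
    exists2 b, B b & forall x, B x -> b <= x.

Definition is_hahn (c : RR -> CC) : Prop := well_ordered (support_hahn c).

Definition hahn_deg (c : RR -> CC) (d : RR) : Prop :=
  c d != 0 /\ forall a, a < d -> c a = 0.

(** Coefficient at t^g of the determinant of a matrix M of Hahn series,
    written out: det M = sum_s sgn(s) prod_i M i (s i), where the n-fold
    product of Hahn series has coefficient at t^g the (finite, by
    well-orderedness) sum over exponent tuples (a_i) with sum_i a_i = g of
    prod_i coef(M i (s i), a_i). *)
Definition hahn_det_coef (n : nat) (M : 'I_n -> 'I_n -> RR -> CC) (g : RR) : CC :=
  \sum_(s : 'S_n) (-1) ^+ s *
    \sum_(al \in [set al : {ffun 'I_n -> RR} |
                   (\sum_i al i = g) /\ (forall i, M i (s i) (al i) != 0)])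
      \prod_i M i (s i) (al i).

Definition symmetric_lift (n : nat) (A : 'M[RR]_n) (M : 'I_n -> 'I_n -> RR -> CC) : Prop :=
  (forall i j, M i j = M j i) /\
  (forall i j, is_hahn (M i j)) /\
  (forall i j, hahn_deg (M i j) (A i j)).

Definition hahn_singular (n : nat) (M : 'I_n -> 'I_n -> RR -> CC) : Prop :=
  forall g, hahn_det_coef M g = 0.

(** The monomial prod_i X_{i,s(i)} in commuting variables with X_{i,j} = X_{j,i}:
    it is recorded as its exponent vector indexed by unordered pairs {i,j},
    represented by (i,j) with i <= j. *)
Definition sym_monomial (n : nat) (s : 'S_n) : {ffun 'I_n * 'I_n -> nat} :=
  [ffun p : 'I_n * 'I_n =>
     if (p.1 <= p.2)%N then
       #|[set k : 'I_n | ((k == p.1) && (s k == p.2)) || ((k == p.2) && (s k == p.1))]|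
     else 0%N].

Definition perm_value (n : nat) (A : 'M[RR]_n) (s : 'S_n) : RR := \sum_i A i (s i).

Definition sym_trop_singular (n : nat) (A : 'M[RR]_n) : Prop :=
  exists s t : 'S_n,
    sym_monomial s != sym_monomial t /\
    perm_value A s = perm_value A t /\
    (forall r : 'S_n, perm_value A s <= perm_value A r).

(* Main.v *)
(** Sufficiency is Kapranov's theorem for this particular hypersurface, done by
    hand. Two minimal monomials differ in the exponent of some X_{p,q}. Put
    M_{i,j} = c_{i,j} t^{A_{i,j}} with generic constants for the other entries
    and M_{p,q} = y t^{A_{p,q}}. Then det M = t^mu (q_0 + q_1 y + q_2 y^2), mu
    being the minimal value, where the q_k have nonnegative degree and, by
    genericity, at least two of them have a nonzero constant term. Such a
    quadratic equation has a root y of degree 0: square roots and inverses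
    exist already among the series with nonnegative exponents only finitely
    many of which lie below any given bound.

    Necessity looks at the coefficient of t^mu in det M. If only one monomial
    attains mu, nothing cancels there: the monomial of a permutation determines
    its cycles as sets, hence its sign. *)
Require Import Defs.
From HB Require Import structures.
From mathcomp Require Import all_boot all_order all_algebra fingroup perm.
From mathcomp Require Import boolp classical_sets fsbigop reals Rstruct complex.
From mathcomp Require Import ring lra.

Set Implicit Arguments.
Unset Strict Implicit.
Unset Printing Implicit Defensive.

Import Order.TTheory GRing.Theory Num.Theory.
Local Open Scope classical_set_scope.
Local Open Scope ring_scope.

(** * Series with left-finite nonnegative support *)

Section LeftFiniteSeries.
Variables (R : realType) (K : fieldType).
Implicit Types (F G : R -> K) (a b x : R).

(** Nonnegative exponents and finitely many of them below each bound: every coefficient of a product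
    is then a sum over an explicit finite list. *)
Definition left_finite F :=
  (forall a, a < 0 -> F a = 0) /\
  (forall N, exists2 r : seq R, uniq r & forall a, a <= N -> F a != 0 -> a \in r).

Record series := Series { coefs :> R -> K; coefsP : left_finite coefs }.

HB.instance Definition _ := gen_eqMixin series.
HB.instance Definition _ := gen_choiceMixin series.

Implicit Types f g h u : series.

Lemma series_ext f g : f =1 g -> f = g.
Proof.
case: f g => [F FP] [G GP] /= /funext FG; rewrite -FG in GP *.
by congr Series; apply: Prop_irrelevance.
Qed.

Lemma coefs_lt0 f a : a < 0 -> f a = 0.
Proof. by case: (coefsP f) => + _; apply. Qed.

Lemma coefs_neq0_ge0 f a : f a != 0 -> 0 <= a.
Proof. by apply: contra_neqT; rewrite -ltNge; apply: coefs_lt0. Qed.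

Lemma support_upto f x :
  exists2 r : seq R, uniq r & forall a, a <= x -> f a != 0 -> a \in r.
Proof. by case: (coefsP f) => _; apply. Qed.

Lemma fsum_seq (T : choiceType) (F : T -> K) (r : seq T) : uniq r ->
  (forall t, t \notin r -> F t = 0) ->
  \sum_(t \in setT) F t = \sum_(t <- r) F t.
Proof.
move=> r_uniq F0; rewrite (fsbigE r) //; last by move=> a _; apply: F0.
by apply: eq_bigl => a; rewrite in_setT.
Qed.

Definition convolution F G x := \sum_(a \in setT) F a * G (x - a).

(** Terms with [a > x] drop out because [g] vanishes at negative exponents. The list may exceed the
    support, so that several products can share one list. *)
Lemma convolutionE f g x (r : seq R) : uniq r ->
  (forall a, a <= x -> f a != 0 -> a \in r) ->
  convolution f g x = \sum_(a <- r) f a * g (x - a).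
Proof.
move=> r_uniq rP; apply: fsum_seq => // a ar.
have [->|fa] := eqVneq (f a) 0; first by rewrite mul0r.
rewrite (@coefs_lt0 g) ?mulr0 // subr_lt0 ltNge; apply: contra ar => ax.
exact: rP.
Qed.

Lemma left_finite0 : left_finite (fun=> 0).
Proof. by split=> // N; exists [::] => // a _; rewrite eqxx. Qed.

Lemma left_finiteN f : left_finite (fun a => - f a).
Proof.
split=> [a a0|N]; first by rewrite coefs_lt0 // oppr0.
have [r ru rP] := support_upto f N; exists r => // a aN.
by rewrite oppr_eq0; apply: rP.
Qed.

Lemma left_finiteD f g : left_finite (fun a => f a + g a).
Proof.
split=> [a a0|N]; first by rewrite !coefs_lt0 // addr0.
have [r ru rP] := support_upto f N; have [q qu qP] := support_upto g N.
exists (undup (r ++ q)) => [|a aN fga]; first exact: undup_uniq.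
rewrite mem_undup mem_cat; have [fa|/rP->//] := eqVneq (f a) 0.
by rewrite qP ?orbT //; apply: contra_neq fga => ->; rewrite fa addr0.
Qed.

(* The monomial is 0 when [d < 0], such exponents being excluded. *)
Lemma left_finite_monomial (c : K) (d : R) :
  left_finite (fun a => if (a == d) && (0 <= d) then c else 0).
Proof.
split=> [a|N]; first by case: eqP => //= ->; rewrite ltNge => /negbTE->.
by exists [:: d] => // a _; rewrite inE; case: (a =P d) => //=; rewrite eqxx.
Qed.

Lemma left_finiteM f g : left_finite (convolution f g).
Proof.
split=> [x x0|N].
  apply: fsbig1 => a _; have [|a0] := ltP a 0.
    by move=> /coefs_lt0->; rewrite mul0r.
  by rewrite (@coefs_lt0 g) ?mulr0 //; lra.
have [r ru rP] := support_upto f N; have [q qu qP] := support_upto g N.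
exists (undup [seq a + b | a <- r, b <- q]) => [|x xN]; first exact: undup_uniq.
rewrite mem_undup; apply: contra_neqT => xrq; apply: fsbig1 => a _.
have [->|fa] := eqVneq (f a) 0; first by rewrite mul0r.
have [->|ga] := eqVneq (g (x - a)) 0; first by rewrite mulr0.
have a0 := coefs_neq0_ge0 fa; have xa0 := coefs_neq0_ge0 ga.
case/negP: xrq; apply/allpairsP; exists (a, x - a) => /=.
by split; [apply: rP|apply: qP|] => //; lra.
Qed.

Definition zeros := Series left_finite0.
Definition opps f := Series (left_finiteN f).
Definition adds f g := Series (left_finiteD f g).
Definition muls f g := Series (left_finiteM f g).
Definition monomial c d := Series (left_finite_monomial c d).

Fact addsA : associative adds.
Proof. by move=> f g h; apply: series_ext => a /=; rewrite addrA. Qed.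
Fact addsC : commutative adds.
Proof. by move=> f g; apply: series_ext => a /=; rewrite addrC. Qed.
Fact add0s : left_id zeros adds.
Proof. by move=> f; apply: series_ext => a /=; rewrite add0r. Qed.
Fact addNs : left_inverse zeros opps adds.
Proof. by move=> f; apply: series_ext => a /=; rewrite addNr. Qed.

HB.instance Definition _ := GRing.isZmodule.Build series addsA addsC add0s addNs.

Fact mulsC : commutative muls.
Proof.
move=> f g; apply: series_ext => x /=; rewrite /convolution.
rewrite (reindex_fsbigT (fun a => x - a)) /=; last first.
  by exists (fun a => x - a) => a; rewrite opprB addrC subrK.
by apply: eq_fsbigr => a _; rewrite mulrC opprB (addrC x) subrK.
Qed.

Fact muls_addl : left_distributive muls adds.
Proof.
move=> f g h; apply: series_ext => x /=.
have [r ru rP] := support_upto f x; have [q qu qP] := support_upto g x.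
have [p pu pP] := support_upto (adds f g) x.
pose s := undup (r ++ q ++ p); have su : uniq s by apply: undup_uniq.
have sE a : a \in s = [|| a \in r, a \in q | a \in p].
  by rewrite mem_undup !mem_cat.
rewrite (@convolutionE f _ _ s) // => [|a ax fa]; last by rewrite sE rP.
rewrite (@convolutionE g _ _ s) // => [|a ax fa]; last by rewrite sE qP ?orbT.
rewrite (@convolutionE (adds f g) _ _ s) // => [|a ax fa]; last first.
  by rewrite sE pP ?orbT.
by rewrite -big_split; apply: eq_bigr => a _; rewrite /= mulrDl.
Qed.

Lemma convolution_monomial c d f x : 0 <= d ->
  convolution (monomial c d) f x = c * f (x - d).
Proof.
move=> d0; rewrite (@convolutionE _ _ _ [:: d]) //; last first.
  by move=> a _ /=; rewrite inE; case: (a =P d) => //=; rewrite eqxx.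
by rewrite big_seq1 /= eqxx d0.
Qed.

Fact mul1s : left_id (monomial 1 0) muls.
Proof.
move=> f; apply: series_ext => x /=.
by rewrite convolution_monomial // subr0 mul1r.
Qed.

Fact mulsA : associative muls.
Proof.
move=> f g h; apply: series_ext => x /=.
have [r ru rP] := support_upto f x.
rewrite (convolutionE (muls g h) ru rP).
have [q qu qP] := support_upto (muls f g) x.
have [p pu pP] := support_upto g x.
(* The list has to serve twice: for the support of [f * g], and, shifted by each [a] in [r], for the
   support of [g]. *)
pose s := undup (q ++ [seq a + b | a <- r, b <- p]).
have su : uniq s by apply: undup_uniq.
rewrite (@convolutionE (muls f g) _ _ s) // => [|a ax fa]; last first.
  by rewrite mem_undup mem_cat qP.
have fgE b : convolution f g b * h (x - b) =
    \sum_(a <- r) f a * g (b - a) * h (x - b).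
  rewrite -mulr_suml; have [bx|xb] := leP b x; last first.
    by rewrite (@coefs_lt0 h) ?subr_lt0 // !mulr0.
  rewrite (@convolutionE _ _ _ r) // => a ab; apply: rP; exact: le_trans bx.
under [RHS]eq_bigr do rewrite /= fgE.
rewrite exchange_big /=; apply: eq_big_seq => a ar.
under [RHS]eq_bigr do rewrite -mulrA.
rewrite -mulr_sumr; have [->|fa] := eqVneq (f a) 0; first by rewrite !mul0r.
have a0 := coefs_neq0_ge0 fa; congr (_ * _).
rewrite (@convolutionE _ _ _ [seq b - a | b <- s]).
- by rewrite big_map; apply: eq_bigr => b _; congr (_ * h _); lra.
- by rewrite map_inj_uniq //; apply: addIr.
move=> c cxa gc; apply/mapP; exists (a + c); last by lra.
rewrite mem_undup mem_cat; apply/orP; right; apply/allpairsP; exists (a, c).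
by split=> //=; apply: pP => //; lra.
Qed.

Fact ones_neq0 : monomial 1 0 != 0 :> series.
Proof.
apply/eqP => /(congr1 (fun f : series => f 0)) /=.
by rewrite eqxx lexx; apply/eqP/oner_neq0.
Qed.

HB.instance Definition _ :=
  GRing.Zmodule_isComNzRing.Build series mulsA mulsC mul1s muls_addl ones_neq0.

End LeftFiniteSeries.

(** * Coefficients, truncations, orders and limits of series *)

Section SeriesTheory.
Variables (R : realType) (K : fieldType).
Implicit Types (f g h u : series R K) (a b d x : R) (c : K).

Lemma coefs0 x : (0 : series R K) x = 0. Proof. by []. Qed.

Lemma coefs1 x : (1 : series R K) x = (x == 0)%:R.
Proof. by rewrite /= lexx andbT; case: eqP. Qed.

Lemma coefsN f x : (- f) x = - f x. Proof. by []. Qed.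

Lemma coefsD f g x : (f + g) x = f x + g x. Proof. by []. Qed.

Lemma coefsB f g x : (f - g) x = f x - g x. Proof. by []. Qed.

Lemma coefs_sum I (r : seq I) (P : pred I) (F : I -> series R K) x :
  (\sum_(i <- r | P i) F i) x = \sum_(i <- r | P i) F i x.
Proof. exact: (big_morph (fun f : series R K => f x)). Qed.

Lemma coefs_monomialM c d f x : 0 <= d -> (monomial c d * f) x = c * f (x - d).
Proof. exact: convolution_monomial. Qed.

Lemma coefsM0 f g : (f * g) 0 = f 0 * g 0.
Proof.
rewrite [LHS](@convolutionE _ _ _ _ _ [:: 0]) => [|//|a a0 /coefs_neq0_ge0 a0'].
  by rewrite big_seq1 subr0.
by rewrite inE; apply/eqP/le_anti/andP.
Qed.

Lemma monomialM c d (c' : K) (d' : R) : 0 <= d -> 0 <= d' ->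
  monomial c d * monomial c' d' = monomial (c * c') (d + d').
Proof.
move=> d0 d'0; apply: series_ext => x; rewrite coefs_monomialM //=.
by rewrite addr_ge0 // d'0 !andbT subr_eq (addrC d); case: eqP; rewrite ?mulr0.
Qed.

Lemma monomialX c m : monomial c 0 ^+ m = monomial (c ^+ m) 0 :> series R K.
Proof. by elim: m => // m IH; rewrite exprS IH monomialM // addr0 -exprS. Qed.

Lemma monomial_prod (I : Type) (r : seq I) (P : pred I) (c : I -> K) (d : I -> R) :
  (forall i, 0 <= d i) ->
  \prod_(i <- r | P i) monomial (c i) (d i) =
  monomial (\prod_(i <- r | P i) c i) (\sum_(i <- r | P i) d i).
Proof.
move=> d0.
suff [_ ->] : 0 <= \sum_(i <- r | P i) d i /\
  \prod_(i <- r | P i) monomial (c i) (d i) =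
  monomial (\prod_(i <- r | P i) c i) (\sum_(i <- r | P i) d i) by [].
elim/big_rec3: _ => // i e e' m _ [e'0 ->].
by rewrite addr_ge0 // monomialM.
Qed.

Definition eq_upto x f g := forall a, a <= x -> f a = g a.

Lemma eq_uptoM x f g (f' g' : series R K) :
  eq_upto x f f' -> eq_upto x g g' -> eq_upto x (f * g) (f' * g').
Proof.
move=> ff' gg' a ax; apply: eq_fsbigr => b _.
have [b0|b0] := ltP b 0; first by rewrite !(@coefs_lt0 _ _ _ b) // !mul0r.
have [ab|ba] := ltP a b; first by rewrite !(@coefs_lt0 _ _ _ (a - b)) ?subr_lt0 // !mulr0.
by rewrite ff' ?gg' //; lra.
Qed.

Definition vanishes_below d f := forall a, a < d -> f a = 0.

Lemma vanishes_belowM d (d' : R) f g : vanishes_below d f -> vanishes_below d' g ->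
  vanishes_below (d + d') (f * g).
Proof.
move=> fd gd x xd; apply: fsbig1 => a _; have [|da] := ltP a d.
  by move=> /fd->; rewrite mul0r.
by rewrite gd ?mulr0 //; lra.
Qed.

Lemma vanishes_belowD d f g : vanishes_below d f -> vanishes_below d g ->
  vanishes_below d (f + g).
Proof. by move=> fd gd x xd; rewrite coefsD fd // gd // addr0. Qed.

Lemma vanishes_belowMr d f g : vanishes_below d f -> vanishes_below d (f * g).
Proof.
move=> fd; rewrite -(addr0 d); apply: vanishes_belowM => //.
by move=> a /coefs_lt0.
Qed.

Lemma vanishes_below_le d (d' : R) f : d' <= d -> vanishes_below d f -> vanishes_below d' f.
Proof. by move=> d'd fd a ad; apply: fd; apply: lt_le_trans d'd. Qed.

(** Below an exponent [x] of the support there are only finitely many others, so the least one is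
    found in a finite list. *)
Lemma exists_order f : f != 0 -> exists2 d, f d != 0 & vanishes_below d f.
Proof.
move=> f0; have [x fx] : exists x, f x != 0.
  apply/not_existsP => F; case/eqP: f0; apply: series_ext => x.
  by apply/eqP; rewrite coefs0 -[_ == _]negbK; apply/negP/F.
have [r _ rP] := support_upto f x.
have xr : (index x r < size r)%N by rewrite index_mem rP.
have := @arg_minP _ _ _ (Ordinal xr) (fun i : 'I__ => f (r`_i) != 0) (fun i => r`_i).
case=> [|i fi imin]; first by rewrite /= nth_index // rP.
have ix : r`_i <= x.
  by have := imin (Ordinal xr); rewrite /= nth_index ?rP //; apply.
exists r`_i => // a ai; apply: contraTeq ai => fa; rewrite -leNgt.
have [ax|/ltW xa] := leP a x; last exact: le_trans xa.
have ar : (index a r < size r)%N by rewrite index_mem rP.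
by have := imin (Ordinal ar); rewrite /= nth_index ?rP //; apply.
Qed.

Lemma lt_bound_norm_div x d : 0 < d -> x < (Num.bound `|x / d|)%:R * d.
Proof.
move=> d0; rewrite -ltr_pdivrMr //; apply: le_lt_trans (ler_norm _) _.
exact: archi_boundP.
Qed.

Lemma vanishes_below_eq0 d f : 0 < d ->
  (forall k : nat, vanishes_below (k%:R * d) f) -> f = 0.
Proof.
move=> d0 fk; apply: series_ext => x; exact: fk (lt_bound_norm_div x d0).
Qed.

(* The sequence is stationary at every exponent, so its limit is taken
   coefficientwise. *)
Lemma exists_limit d (F : nat -> series R K) : 0 < d ->
  (forall k, vanishes_below (k%:R * d) (F k.+1 - F k)) ->
  exists f, forall k, vanishes_below (k%:R * d) (f - F k).
Proof.
move=> d0 Fk.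
have Fstat k l x : (k <= l)%N -> x < k%:R * d -> F l x = F k x.
  elim: l => [|l IH]; first by rewrite leqn0 => /eqP->.
  rewrite leq_eqVlt => /orP[/eqP<-//|]; rewrite ltnS => kl xk.
  rewrite -IH //; apply/eqP; rewrite -subr_eq0 -coefsB; apply/eqP/Fk.
  by apply: lt_le_trans xk _; rewrite ler_pM2r // ler_nat.
(* From the index [N x] on, the coefficient at [x] no longer changes. *)
pose N x := Num.bound `|x / d|.
have NP x : x < (N x)%:R * d by apply: lt_bound_norm_div.
have FN k x : x < k%:R * d -> F (N x) x = F k x.
  move=> xk; have [kN|/ltnW Nk] := leqP k (N x); first exact: Fstat.
  by rewrite (Fstat _ _ _ Nk).
(* Up to [y] the limit coincides with the single series [F (N y)]. *)
have lim_left_finite : left_finite (fun x => F (N x) x).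
  split=> [x x0|y]; first by rewrite coefs_lt0.
  have [r ru rP] := support_upto (F (N y)) y; exists r => // x xy.
  by rewrite (FN (N y)) ?(le_lt_trans xy) //; apply: rP.
exists (Series lim_left_finite) => k x xk.
by rewrite coefsB /= (FN k) // subrr.
Qed.

(** Links the sum over exponent tuples in [hahn_det_coef] to products in the ring of series. Up to
    [x] each factor is a finite sum of monomials over a common exponent list, and the product of
    these sums is expanded by distributivity. *)
Lemma coefs_prod n (F : 'I_n -> series R K) x :
  \sum_(al \in [set al : {ffun 'I_n -> R} |
                 \sum_i al i = x /\ forall i, F i (al i) != 0])
    \prod_i F i (al i) = (\prod_i F i) x.
Proof.
have /choice[r rP] (i : 'I_n) : exists r : seq R,
    forall a, a <= x -> F i a != 0 -> a \in r.
  by have [r _ rP] := support_upto (F i) x; exists r.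
pose s := [seq a <- undup (flatten [seq r i | i <- enum 'I_n]) | 0 <= a].
have su : uniq s by rewrite filter_uniq // undup_uniq.
have s0 (j : 'I_(size s)) : 0 <= s`_j.
  by have := mem_nth 0 (ltn_ord j); rewrite mem_filter => /andP[].
have sP i a : a <= x -> F i a != 0 -> a \in s.
  move=> ax Fa; rewrite mem_filter (coefs_neq0_ge0 Fa) mem_undup.
  by apply/flatten_mapP; exists i; rewrite ?mem_enum //; apply: rP.
pose G i := \sum_(j < size s) monomial (F i s`_j) s`_j.
have FG i : eq_upto x (F i) (G i).
  move=> a ax; rewrite coefs_sum.
  have -> : \sum_(j < size s) monomial (F i s`_j) s`_j a =
            \sum_(b <- s | b == a) F i a.
    rewrite (big_nth 0) big_mkord [RHS]big_mkcond /=.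
    by apply: eq_bigr => j _; rewrite s0 andbT eq_sym; case: eqP => // ->.
  have [as_|as_] := boolP (a \in s); first by rewrite -big_filter filter_pred1_uniq // big_seq1.
  have -> : F i a = 0 by apply: contraNeq as_; exact: sP.
  by rewrite big1.
have -> : (\prod_i F i) x = (\prod_i G i) x.
  suff : eq_upto x (\prod_i F i) (\prod_i G i) by apply.
  by elim/big_ind2: _ => // f1 f2 g1 g2; apply: eq_uptoM.
rewrite bigA_distr_bigA coefs_sum fsbig_mkcond.
(* A choice of one monomial per factor is the same as an exponent tuple with entries in [s]. *)
pose em (phi : {ffun 'I_n -> 'I_(size s)}) := [ffun i => s`_(phi i)].
have em_inj : injective em.
  move=> phi psi /ffunP E; apply/ffunP => i; have := E i; rewrite !ffunE.
  by move=> /eqP; rewrite nth_uniq // => /eqP /val_inj.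
rewrite (@fsum_seq _ _ _ (map em (enum {ffun 'I_n -> 'I_(size s)}))).
- rewrite big_map big_enum /=; apply: eq_bigr => phi _.
  rewrite monomial_prod //= sumr_ge0 // andbT.
  have emE i : em phi i = s`_(phi i) by rewrite ffunE.
  under [in RHS]eq_bigr do rewrite -emE.
  under [in X in _ = if _ then X else _]eq_bigr do rewrite -emE.
  rewrite /functions.patch; case: ifPn => [|]; first by rewrite inE => -[-> _]; rewrite eqxx.
  rewrite notin_setE /= => D; case: eqP => // E.
  apply/esym/eqP/prodf_eq0; apply: contra_notP D => D; split=> // i.
  by apply/negP => /eqP Fi; case: D; exists i; rewrite ?Fi.
- by rewrite map_inj_uniq // enum_uniq.
move=> al al_s; rewrite /functions.patch; case: ifPn => //; rewrite inE => -[alx alF].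
case/negP: al_s; apply/mapP.
(* The other exponents are nonnegative, so none can exceed the total [x]. *)
have alx' i : al i <= x.
  rewrite -alx (bigD1 i) //= lerDl sumr_ge0 // => j _.
  exact: coefs_neq0_ge0 (alF j).
have al_s i : (index (al i) s < size s)%N by rewrite index_mem (sP i).
exists [ffun i => Ordinal (al_s i)]; first by rewrite mem_enum.
by apply/ffunP => i; rewrite !ffunE /= nth_index // (sP i).
Qed.

(** The factors are t^(b i) times [F i]. Here [b i] may be negative, so these need not be series of
    the ring, but their product can still be computed there. *)
Lemma coefs_prod_shift n (F : 'I_n -> series R K) (b : 'I_n -> R) x :
  \sum_(al \in [set al : {ffun 'I_n -> R} |
                 \sum_i al i = x /\ forall i, F i (al i - b i) != 0])
    \prod_i F i (al i - b i) = (\prod_i F i) (x - \sum_i b i).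
Proof.
rewrite -coefs_prod fsbig_mkcond [RHS]fsbig_mkcond.
rewrite (reindex_fsbigT (fun al : {ffun 'I_n -> R} => [ffun i => al i + b i])) /=; last first.
  by exists (fun al : {ffun 'I_n -> R} => [ffun i => al i - b i]) => al;
    apply/ffunP => i; rewrite !ffunE ?addrK ?subrK.
apply: eq_fsbigr => al _; rewrite /functions.patch.
have alE i : [ffun i => al i + b i] i - b i = al i by rewrite ffunE addrK.
have sumE : \sum_i [ffun i => al i + b i] i = \sum_i al i + \sum_i b i.
  by rewrite -big_split; apply: eq_bigr => i _; rewrite ffunE.
under eq_bigr do rewrite alE.
congr (if _ then _ else _); apply/idP/idP; rewrite !inE /= sumE => -[alx Fal].
  by split=> [|i]; [rewrite -alx addrK|rewrite -alE].
by split=> [|i]; [rewrite alx subrK|rewrite alE].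
Qed.

End SeriesTheory.

(** * Square roots and quadratic equations *)

Section SeriesRoots.
Variables (R : realType) (K : numClosedFieldType).
Implicit Types (a b c f g h u : series R K) (d x : R).

Local Notation half := (monomial 2^-1 0 : series R K).

Lemma monomial_half2 : 2 * half = 1.
Proof.
rewrite mulr2n mulrDl mul1r; apply: series_ext => x; rewrite coefsD coefs1 /= lexx andbT.
by case: eqP => _; rewrite ?addr0 // [RHS]splitr div1r.
Qed.

(* Newton's iteration r <- r (1 + e/2), where e = 1 - r^2 (1 + u), squares the
   error up to a factor. *)
Lemma exists_inv_sqrt u : u 0 = 0 -> exists r, r ^+ 2 * (1 + u) = 1.
Proof.
move=> u0; have [d d0 ud] : exists2 d, 0 < d & vanishes_below d u.
  have [->|/exists_order[d ud dP]] := eqVneq u 0; first by exists 1.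
  exists d => //; rewrite lt_neqAle (coefs_neq0_ge0 ud) andbT.
  by apply: contraTneq ud => <-; rewrite u0 eqxx.
pose err r := 1 - r ^+ 2 * (1 + u).
pose F k := iter k (fun r => r + half * err r * r) 1.
have errS r : err (r + half * err r * r) =
    err r * err r * (1 - half ^+ 2 + half ^+ 2 * err r).
  have : r ^+ 2 * (1 + u) = 1 - err r by rewrite subKr.
  move: (err r) => e eE.
  have -> : err (r + half * e * r) =
      1 - r ^+ 2 * (1 + u) * (1 + 2 * half * e + half ^+ 2 * e ^+ 2).
    by rewrite /err; ring.
  by rewrite eE monomial_half2; ring.
(* The order of the error at least doubles at each step; the linear bound is enough and has the form
   that [exists_limit] asks for. *)
have errF k : vanishes_below (k.+1%:R * d) (err (F k)).
  elim: k => [|k IH].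
    rewrite mul1r /err /= expr1n mul1r opprD addNKr.
    by move=> x xd; rewrite coefsN ud // oppr0.
  rewrite /= errS; apply: vanishes_belowMr.
  apply: vanishes_below_le (vanishes_belowM IH IH).
  by rewrite -mulrDl ler_pM2r // -natrD ler_nat addSn addnS !ltnS leq_addr.
have [r rP] : exists r, forall k, vanishes_below (k%:R * d) (r - F k).
  apply: exists_limit => // k; rewrite /= addrC addKr.
  rewrite mulrAC [half * _ * _]mulrC; apply: vanishes_belowMr.
  by apply: vanishes_below_le (errF k); rewrite ler_pM2r // ler_nat.
exists r; apply/eqP; rewrite -subr_eq0; apply/eqP.
apply: (vanishes_below_eq0 d0) => k.
have -> : r ^+ 2 * (1 + u) - 1 =
    (r - F k) * ((r + F k) * (1 + u)) + err (F k) * (- 1).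
  by rewrite /err; ring.
apply: vanishes_belowD; apply: vanishes_belowMr => //.
by apply: vanishes_below_le (errF k); rewrite ler_pM2r // ler_nat.
Qed.

Lemma exists_shift d f : 0 <= d -> vanishes_below d f ->
  exists g, (forall x, g x = f (x + d)) /\ f = monomial 1 d * g.
Proof.
move=> d0 fd; have shift_lf : left_finite (fun x => f (x + d)).
  split=> [x x0|N]; first by rewrite fd // gtrDr.
  have [r ru rP] := support_upto f (N + d).
  exists [seq x - d | x <- r] => [|x xN fx].
    by rewrite map_inj_uniq //; apply: addIr.
  by apply/mapP; exists (x + d); rewrite ?addrK // rP // lerD2r.
exists (Series shift_lf); split=> //; apply: series_ext => x.
by rewrite coefs_monomialM //= mul1r subrK.
Qed.

Lemma unit_normal_form f : f 0 != 0 ->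
  exists2 u : series R K, u 0 = 0 & f = monomial (f 0) 0 * (1 + u).
Proof.
move=> f0; exists (monomial (f 0)^-1 0 * f - 1).
  by rewrite coefsB coefsM0 coefs1 /= eqxx lexx mulVf // subrr.
rewrite addrC subrK mulrA monomialM // mulfV // addr0.
by rewrite [RHS]mul1r.
Qed.

(** The square of an inverse square root of [1 + u] is an inverse of [1 + u]. *)
Lemma exists_inverse f : f 0 != 0 -> exists g, f * g = 1.
Proof.
move=> f0; have [u /exists_inv_sqrt[r ru] fE] := unit_normal_form f0.
exists (monomial (f 0)^-1 0 * r ^+ 2); rewrite [X in X * _]fE.
rewrite mulrACA monomialM // mulfV // addr0 (mulrC (1 + u)).
by rewrite ru mulr1.
Qed.

(** Write [f] as c t^d (1 + u). If r^2 (1 + u) = 1, then r (1 + u) is a square root of 1 + u, and c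
    and t^d have square roots as well. *)
Lemma exists_sqrt f : exists s, s ^+ 2 = f.
Proof.
have [->|f0] := eqVneq f 0; first by exists 0; rewrite expr0n.
have [d fd dP] := exists_order f0; have d0 := coefs_neq0_ge0 fd.
have [g [gE ->]] := exists_shift d0 dP.
have g0 : g 0 != 0 by rewrite gE add0r.
have [u /exists_inv_sqrt[r ru] ->] := unit_normal_form g0.
have d20 : 0 <= d / 2 by rewrite divr_ge0.
exists (monomial (sqrtC (g 0)) (d / 2) * (r * (1 + u))).
rewrite exprMn [monomial _ _ ^+ 2]expr2 monomialM // -expr2 sqrtCK -splitr.
have -> : (r * (1 + u)) ^+ 2 = r ^+ 2 * (1 + u) * (1 + u) by ring.
by rewrite ru mul1r mulrA monomialM // mul1r addr0.
Qed.

(** The quadratic formula gives two roots. By Vieta's formulas, if both had constant term 0, so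
    would [b] and [c]. *)
Lemma quadratic_root_lead a b c : a 0 != 0 -> (b 0 != 0) || (c 0 != 0) ->
  exists2 y : series R K, y 0 != 0 & c + b * y + a * y ^+ 2 = 0.
Proof.
move=> a0 bc0; have [i ai] := exists_inverse a0.
have [s sE] := exists_sqrt (b ^+ 2 - 4 * a * c).
have h2 := monomial_half2.
have rootP t : t ^+ 2 = b ^+ 2 - 4 * a * c ->
    c + b * ((- b + t) * half * i) + a * ((- b + t) * half * i) ^+ 2 = 0.
  (* Each summand on the right contains a factor that vanishes by [ai], [h2] or [tE]. *)
  move=> tE; have -> : c + b * ((- b + t) * half * i) +
      a * ((- b + t) * half * i) ^+ 2 =
      (a * i - 1) * (i * half ^+ 2 * (- b + t) ^+ 2 - 4 * half ^+ 2 * c)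
      - b * (- b + t) * i * half * (2 * half - 1)
      + i * half ^+ 2 * (t ^+ 2 - (b ^+ 2 - 4 * a * c))
      - c * (2 * half - 1) * (2 * half + 1) by ring.
  by rewrite ai h2 tE !subrr !(mul0r, mulr0, oppr0, addr0).
have [y1|] := boolP (((- b + s) * half * i) 0 != 0).
  by exists ((- b + s) * half * i) => //; apply: rootP.
have [y2 _|] := boolP (((- b - s) * half * i) 0 != 0).
  by exists ((- b - s) * half * i) => //; apply: rootP; rewrite sqrrN.
rewrite !negbK => /eqP y2 /eqP y1; exfalso.
have b0 : b 0 = 0.
  have -> : b = - a * (((- b + s) * half * i) + ((- b - s) * half * i)).
    have -> : - a * (((- b + s) * half * i) + ((- b - s) * half * i)) =
      b * (a * i) * (2 * half) by ring.
    by rewrite ai h2 !mulr1.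
  by rewrite coefsM0 coefsD y1 y2 addr0 mulr0.
have c0 : c 0 = 0.
  have -> : c = a * (((- b + s) * half * i) * ((- b - s) * half * i)).
    have -> : a * (((- b + s) * half * i) * ((- b - s) * half * i)) =
      a * i * i * half ^+ 2 * (b ^+ 2 - s ^+ 2) by ring.
    rewrite sE.
    have -> : a * i * i * half ^+ 2 * (b ^+ 2 - (b ^+ 2 - 4 * a * c)) =
      (a * i) * (a * i) * (2 * half) * (2 * half) * c by ring.
    by rewrite ai h2 !mul1r.
  by rewrite coefsM0 coefsM0 y1 mul0r mulr0.
by move: bc0; rewrite b0 c0 eqxx.
Qed.

Lemma quadratic_root (q : nat -> series R K) (k l : nat) :
  (k <= 2)%N -> (l <= 2)%N -> k != l -> q k 0 != 0 -> q l 0 != 0 ->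
  exists2 y : series R K, y 0 != 0 & q 0 + q 1 * y + q 2 * y ^+ 2 = 0.
Proof.
move=> k2 l2 kl qk ql; have [q2|q2] := eqVneq (q 2 0) 0.
  have [q0 q1] : q 0 0 != 0 /\ q 1 0 != 0.
    case: k l k2 l2 kl qk ql => [|[|[|//]]] [|[|[|//]]] // _ _ _; by rewrite ?q2 ?eqxx.
  (* The leading coefficient is not a unit: solve the reversed equation and invert its root. *)
  have [|z z0 zE] := @quadratic_root_lead (q 0) (q 1) (q 2) q0; first by rewrite q1.
  have [y zy] := exists_inverse z0; exists y.
    have := congr1 (fun f : series R K => f 0) zy; rewrite coefsM0 coefs1 eqxx.
    by apply: contra_eq_neq => ->; rewrite mulr0 eq_sym oner_neq0.
  have -> : q 0 + q 1 * y + q 2 * y ^+ 2 =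
      (q 2 + q 1 * z + q 0 * z ^+ 2) * y ^+ 2
      - q 1 * y * (z * y - 1) - q 0 * (z * y - 1) * (z * y + 1) by ring.
  by rewrite zE zy subrr !(mul0r, mulr0) !subr0.
apply: quadratic_root_lead => //.
case: k l k2 l2 kl qk ql => [|[|[|//]]] [|[|[|//]]] // _ _ _ qk ql;
  by rewrite ?qk ?ql ?orbT.
Qed.

End SeriesRoots.

(** * Monomials of the symmetric determinant *)

Section SymmetricMonomials.
Variable n : nat.
Implicit Types (s t : 'S_n) (p : 'I_n * 'I_n).

Definition ordered_pair (i j : 'I_n) := if (i <= j)%N then (i, j) else (j, i).

Lemma ordered_pairC i j : ordered_pair i j = ordered_pair j i.
Proof.
by rewrite /ordered_pair; case: (ltngtP i j) => // /val_inj ->.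
Qed.

Lemma ordered_pairP i j k l : ordered_pair i j = ordered_pair k l ->
  (i = k /\ j = l) \/ (i = l /\ j = k).
Proof. by rewrite /ordered_pair; do 2!case: ifP => _; case=> -> ->; auto. Qed.

Lemma sym_monomialE s p :
  sym_monomial s p = #|[pred k | ordered_pair k (s k) == p]|.
Proof.
case: p => i j; rewrite ffunE /=; case: ifPn => ij.
  have ijE : (i, j) = ordered_pair i j by rewrite /ordered_pair ij.
  apply: eq_card => k; rewrite ijE; apply/idP/idP; rewrite !inE /=.
    by case/orP=> /andP[/eqP-> /eqP->] //; rewrite ordered_pairC.
  by move=> /eqP/ordered_pairP[][<- <-]; rewrite !eqxx ?orbT.
apply/esym/eq_card0 => k; rewrite !inE; apply/negP => /eqP; rewrite /ordered_pair.
case: ifPn => [kk [ki kj]|]; first by rewrite -ki -kj kk in ij.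
by rewrite -ltnNge => /ltnW + [ki kj]; rewrite ki kj (negbTE ij).
Qed.

Lemma sym_monomial_le s p : (sym_monomial s p <= n)%N.
Proof. by rewrite sym_monomialE -[leqRHS]card_ord max_card. Qed.

(** Only the two indices in [p] can contribute. Hence the determinant is at most quadratic in each
    variable. *)
Lemma sym_monomial_le2 s p : (sym_monomial s p <= 2)%N.
Proof.
rewrite sym_monomialE; apply: leq_trans (_ : #|pred2 p.1 p.2| <= 2)%N; last first.
  by rewrite card2; case: eqP.
apply/subset_leq_card/fintype.subsetP => k; rewrite !inE /ordered_pair => /eqP <-.
by case: ifP; rewrite eqxx ?orbT.
Qed.

Lemma sym_monomial_prod (K : comNzRingType) (F : 'I_n * 'I_n -> K) s :
  \prod_i F (ordered_pair i (s i)) = \prod_p F p ^+ sym_monomial s p.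
Proof.
rewrite (partition_big (fun i => ordered_pair i (s i)) predT) //=.
apply: eq_bigr => p _; rewrite (eq_bigr (fun=> F p)) => [|i /eqP-> //].
by rewrite prodr_const sym_monomialE; congr (_ ^+ _); apply: eq_card => k; rewrite !inE.
Qed.

Lemma sym_monomial_edge s t k : sym_monomial s = sym_monomial t ->
  t k = s k \/ t (s k) = k.
Proof.
move=> /ffunP/(_ (ordered_pair k (s k))); rewrite !sym_monomialE => st.
have : (0 < #|[pred l | ordered_pair l (t l) == ordered_pair k (s k)]|)%N.
  by rewrite -st; apply/card_gt0P; exists k; rewrite inE.
case/card_gt0P => l; rewrite inE => /eqP /ordered_pairP[][-> ->]; by [left|right].
Qed.

(** One step of [t] or of its inverse joins [k] to [s k], so [s] never leaves a cycle of [t]. *)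
Lemma sub_porbit_edges s t x : (forall k, t k = s k \/ t (s k) = k) ->
  porbit s x \subset porbit t x.
Proof.
move=> st; have step z : porbit t (s z) = porbit t z.
  case: (st z) => [<-|{2}<-]; first exact: (porbit_perm t 1).
  by apply/esym; apply: (porbit_perm t 1).
apply/fintype.subsetP => y /porbitP[i ->]; rewrite -eq_porbit_mem; apply/eqP.
by elim: i => [|i IH]; rewrite ?expg0 ?perm1 // expgSr permM step.
Qed.

(** The cycles agree as sets, though perhaps not in direction, and the sign depends only on their
    number. *)
Lemma sym_monomial_odd s t : sym_monomial s = sym_monomial t -> odd_perm s = odd_perm t.
Proof.
move=> st; suff sub : porbits s = porbits t by rewrite /odd_perm sub.
apply: eq_imset => x; apply/eqP; rewrite finset.eqEsubset.
by apply/andP; split; apply: sub_porbit_edges => k; apply: sym_monomial_edge.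
Qed.

End SymmetricMonomials.

(** * Kronecker substitution: one parameter in place of many generic constants *)

Lemma digits_inj (B m : nat) (a b : 'I_m -> nat) :
  (forall i, a i < B)%N -> (forall i, b i < B)%N ->
  (\sum_i a i * B ^ i = \sum_i b i * B ^ i)%N -> a =1 b.
Proof.
elim: m a b => [|m IH] a b aB bB; first by move=> _ [].
rewrite !big_ord_recl !expn0 !muln1.
have shiftE (c : 'I_m.+1 -> nat) : (\sum_(i < m) c (lift ord0 i) * B ^ lift ord0 i =
    (\sum_(i < m) c (lift ord0 i) * B ^ i) * B)%N.
  by rewrite big_distrl; apply: eq_bigr => i _; rewrite expnS mulnCA [LHS]mulnC.
rewrite !shiftE => E; have B0 : (0 < B)%N := leq_ltn_trans (leq0n _) (aB ord0).
have E0 : a ord0 = b ord0.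
  by have := congr1 (modn^~ B) E; rewrite !(addnC _ (_ * _)%N) !modnMDl !modn_small.
have /IH E1 : (\sum_(i < m) a (lift ord0 i) * B ^ i =
               \sum_(i < m) b (lift ord0 i) * B ^ i)%N.
  by move/eqP: E; rewrite E0 eqn_add2l eqn_pmul2r // => /eqP.
by move=> i; case: (unliftP ord0 i) => [j ->|->] //; apply: E1.
Qed.

Section KroneckerWeights.
Variables (n : nat) (p0 : 'I_n * 'I_n).
Implicit Types s t r : 'S_n.

(** Exponents in a monomial are at most [n], so they can be read off as digits in base [n.+1]. *)
Definition pair_weight (p : 'I_n * 'I_n) := (n.+1 ^ enum_rank p)%N.

(** The variable at [p0] is left out because it stays the unknown of the quadratic equation. *)
Definition kronecker_weight s :=
  (\sum_(p | p != p0) sym_monomial s p * pair_weight p)%N.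

Lemma kronecker_weight_inj s t : sym_monomial s p0 = sym_monomial t p0 ->
  kronecker_weight s = kronecker_weight t -> sym_monomial s = sym_monomial t.
Proof.
move=> st0 w_st.
pose digit r (i : 'I_#|{: 'I_n * 'I_n}|) :=
  if enum_val i != p0 then sym_monomial r (enum_val i) else 0%N.
have digitE r : (\sum_i digit r i * n.+1 ^ i)%N = kronecker_weight r.
  rewrite /kronecker_weight [RHS]big_mkcond /=.
  rewrite (reindex (fun i : 'I_#|{: 'I_n * 'I_n}| => enum_val i)) /=; last first.
    exact: onW_bij (@enum_val_bij _).
  by apply: eq_bigr => i _; rewrite /digit /pair_weight enum_valK; case: ifP.
have digit_lt r i : (digit r i < n.+1)%N.
  by rewrite /digit; case: ifP => // _; rewrite ltnS sym_monomial_le.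
have E : digit s =1 digit t.
  by apply: (@digits_inj n.+1) => //; rewrite !digitE.
apply/ffunP => p; have [->//|pp0] := eqVneq p p0.
by have := E (enum_rank p); rewrite /digit enum_rankK pp0.
Qed.

(* Distinct monomials have distinct weights and a monomial determines the
   sign, so nothing cancels. *)
Lemma kronecker_poly_neq0 (K : numDomainType) (P : pred 'S_n) s : P s ->
  \sum_(r | P r && (sym_monomial r p0 == sym_monomial s p0))
     (-1) ^+ r *: 'X^(kronecker_weight r) != 0 :> {poly K}.
Proof.
move=> Ps; apply/eqP => /(congr1 (fun q : {poly K} => q`_(kronecker_weight s))).
rewrite coef0 coef_sum => E.
(* The permutations contributing to the coefficient at the weight of [s]. All have the sign of [s],
   so the coefficient is plus or minus their number. *)
pose Q r := [&& P r, sym_monomial r p0 == sym_monomial s p0 &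
                kronecker_weight s == kronecker_weight r].
have : \sum_(r | Q r) (-1) ^+ s = 0 :> K.
  rewrite -[RHS]E [RHS]big_mkcondr big_mkcondl [RHS]big_mkcond.
  rewrite big_mkcond; apply: eq_bigr => r _; rewrite /Q coefZ coefXn.
  case: (P r) => //=; case: eqP => //= r0; case: eqP => /= w; rewrite ?mulr0 //.
  by rewrite mulr1 (sym_monomial_odd (kronecker_weight_inj r0 (esym w))).
rewrite sumr_const => /eqP; rewrite -mulr_natr mulf_eq0 signr_eq0 /= pnatr_eq0.
by apply/negP; rewrite -lt0n; apply/card_gt0P; exists s; rewrite unfold_in /Q Ps !eqxx.
Qed.

End KroneckerWeights.

(** * Symmetric lifts *)

(** A tuple that contributes has entries at least [d i] and total [x], at most the sum of the [d i];
    it must be [d] itself. *)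
Lemma fsum_prod_lead (R : realType) (K : fieldType) n (F : 'I_n -> R -> K)
    (d : 'I_n -> R) (x : R) :
  (forall i, F i (d i) != 0 /\ forall a, a < d i -> F i a = 0) -> x <= \sum_i d i ->
  \sum_(al \in [set al : {ffun 'I_n -> R} |
                 \sum_i al i = x /\ forall i, F i (al i) != 0])
    \prod_i F i (al i) = if \sum_i d i == x then \prod_i F i (d i) else 0.
Proof.
move=> Fd xd; set D := [set al | _].
have D1 (al : {ffun 'I_n -> R}) : D al -> \sum_i d i = x /\ al = [ffun i => d i].
  move=> [alx alF].
  have dal i : 0 <= al i - d i.
    rewrite subr_ge0 leNgt; apply/negP => /(proj2 (Fd i)) F0.
    by have := alF i; rewrite F0 eqxx.
  have : \sum_i (al i - d i) <= 0 by rewrite sumrB alx subr_le0.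
  move=> sum0; have {}sum0 : \sum_i (al i - d i) = 0.
    by apply/le_anti/andP; split=> //; apply: sumr_ge0.
  split; first by rewrite -alx -[RHS](subrK (\sum_i d i)) -sumrB sum0 add0r.
  apply/ffunP => i; rewrite ffunE; apply/eqP; rewrite -subr_eq0; apply/eqP.
  exact: (psumr_eq0P (fun i _ => dal i) sum0).
case: eqP => dx.
  have -> : D = [set [ffun i => d i]].
    apply/seteqP; split=> [al /D1[]//|_ ->]; split=> [|i]; last first.
      by rewrite ffunE; case: (Fd i).
    by rewrite -dx; apply: eq_bigr => i _; rewrite ffunE.
  by rewrite fsbig_set1; apply: eq_bigr => i _; rewrite ffunE.
have -> : D = set0 by apply/seteqP; split=> // al /D1[].
exact: fsbig_set0.
Qed.

Lemma singular_lift_trop_singular n (A : 'M[RR]_n) (M : 'I_n -> 'I_n -> RR -> CC) :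
  A^T = A -> symmetric_lift A M -> hahn_singular M -> sym_trop_singular A.
Proof.
move=> AT [MT [_ Mdeg]] Msing.
have AC i j : A i j = A j i by rewrite -[in LHS]AT mxE.
have := @arg_minP _ _ _ (1%g : 'S_n) predT (perm_value A) isT.
case=> s _ smin; apply: contrapT => ns.
have mono_min r : perm_value A r = perm_value A s -> sym_monomial r = sym_monomial s.
  move=> rs; apply/eqP; apply: contrapT => /negP nrs; apply: ns; exists s, r.
  by split; [rewrite eq_sym|split=> // t; apply: smin].
(* By symmetry the leading coefficients depend only on the unordered pair, so permutations with
   equal monomials give equal products. *)
pose L p : CC := M p.1 p.2 (A p.1 p.2).
have LE i j : M i j (A i j) = L (ordered_pair i j).
  by rewrite /ordered_pair; case: ifP => // _; rewrite /L /= MT AC.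
have := Msing (perm_value A s); rewrite /hahn_det_coef.
have inner (r : 'S_n) : (-1) ^+ r *
    \sum_(al \in [set al : {ffun 'I_n -> RR} |
                   (\sum_i al i = perm_value A s) /\ (forall i, M i (r i) (al i) != 0)])
      \prod_i M i (r i) (al i) =
    if perm_value A r == perm_value A s then
      (-1) ^+ s * \prod_i L (ordered_pair i (s i)) else 0.
  rewrite (fsum_prod_lead (fun i => Mdeg i (r i))); last exact: smin.
  rewrite -/(perm_value A r); case: eqP => rs; last by rewrite mulr0.
  rewrite (sym_monomial_odd (mono_min _ rs)) sym_monomial_prod -(mono_min _ rs).
  by rewrite -sym_monomial_prod; congr (_ * _); apply: eq_bigr => i _; rewrite LE.
(* The coefficient is the number of minimizing permutations times one nonzero term. *)
rewrite (eq_bigr _ (fun r _ => inner r)) -big_mkcond sumr_const => /eqP.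
apply/negP; rewrite mulrn_eq0 negb_or mulf_neq0 ?signr_eq0 //; last first.
  by apply/prodf_neq0 => i _; rewrite -LE; case: (Mdeg i (s i)).
by rewrite andbT -lt0n; apply/card_gt0P; exists s; apply: eqxx.
Qed.

(** Restricting [f] to the shifted subset gives again a left-finite series; its order yields the
    least element. *)
Lemma series_shift_is_hahn (f : series RR CC) (d : RR) : is_hahn (fun x => f (x - d)).
Proof.
move=> B Bf [b Bb].
have cut_lf : left_finite (fun x => if `[< B (x + d) >] then f x else 0).
  split=> [x x0|N]; first by rewrite coefs_lt0 //; case: ifP.
  have [r ru rP] := support_upto f N; exists r => // a aN.
  by case: ifP => _; [apply: rP|rewrite eqxx].
have Bcut x : B x -> Series cut_lf (x - d) != 0.
  by move=> Bx; rewrite /= subrK asboolT //; apply: Bf.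
have [|m mB m_min] := @exists_order _ _ (Series cut_lf).
  by apply: contraTneq (Bcut b Bb) => ->; rewrite coefs0 eqxx.
exists (m + d).
  by move: mB => /=; case: asboolP => //; rewrite eqxx.
move=> x Bx; rewrite -lerBrDr leNgt; apply/negP => /m_min.
by apply/eqP/Bcut.
Qed.

Lemma trop_singular_singular_lift n (A : 'M[RR]_n) :
  A^T = A -> sym_trop_singular A ->
  exists M : 'I_n -> 'I_n -> RR -> CC, symmetric_lift A M /\ hahn_singular M.
Proof.
move=> AT [s [t [st [st_val smin]]]].
have AC i j : A i j = A j i by rewrite -[in LHS]AT mxE.
pose mu := perm_value A s.
have [p0 p0st] : exists p0, sym_monomial s p0 != sym_monomial t p0.
  apply/not_existsP => E; case/eqP: st; apply/ffunP => p; apply/eqP.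
  by apply: contrapT => /negP; apply: E.
pose e (r : 'S_n) := sym_monomial r p0; pose w := @kronecker_weight n p0.
(* The constant term of the coefficient [q k] below, as a polynomial in the parameter [z]. *)
pose Q k : {poly CC} := \sum_(r : 'S_n | (perm_value A r == mu) && (e r == k))
  (-1) ^+ r *: 'X^(w r).
have Qs : Q (e s) != 0 by apply: (@kronecker_poly_neq0 _ _ _ (fun r => perm_value A r == mu)).
have Qt : Q (e t) != 0.
  by apply: (@kronecker_poly_neq0 _ _ _ (fun r => perm_value A r == mu)); apply/eqP.
(* The factor ['X] makes [z] nonzero, so that the entries z^([pair_weight p]) are units. *)
have [z] : exists z, ~~ root ('X * Q (e s) * Q (e t)) z.
  by apply/closed_nonrootP; rewrite !mulf_neq0 // polyX_eq0.
rewrite !rootM rootX !negb_or -!andbA /root => /and3P[z0 Qsz Qtz].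
have val_ge0 r : 0 <= perm_value A r - mu by rewrite subr_ge0; apply: smin.
pose q k : series RR CC :=
  \sum_(r : 'S_n | e r == k) monomial ((-1) ^+ r * z ^+ w r) (perm_value A r - mu).
have q0E k : q k 0 = (Q k).[z].
  rewrite coefs_sum horner_sum [RHS]big_mkcond [LHS]big_mkcond; apply: eq_bigr => r _.
  rewrite andbC; case: (e r == k) => //=; rewrite val_ge0 andbT eq_sym subr_eq0.
  by case: eqP; rewrite ?hornerZ ?hornerXn.
have [y y0 yroot] : exists2 y : series RR CC, y 0 != 0 & q 0 + q 1 * y + q 2 * y ^+ 2 = 0.
  by apply: (@quadratic_root _ _ _ (e s) (e t)); rewrite ?sym_monomial_le2 ?q0E.
pose G p : series RR CC := if p == p0 then y else monomial (z ^+ pair_weight p) 0.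
have G0 p : G p 0 != 0.
  by rewrite /G; case: (p =P p0) => //= _; rewrite eqxx lexx expf_neq0.
have GE (r : 'S_n) : \prod_i G (ordered_pair i (r i)) = monomial (z ^+ w r) 0 * y ^+ e r.
  rewrite sym_monomial_prod (bigD1 p0) //= {1}/G eqxx mulrC; congr (_ * _).
  rewrite (eq_bigr (fun p => monomial (z ^+ (sym_monomial r p * pair_weight p)%N) 0)).
    by rewrite monomial_prod // big1_eq -expr_sum.
  by move=> p pp0; rewrite /G (negbTE pp0) monomialX -exprM mulnC.
(* The entry is t^(A i j) times a series with nonzero constant term, hence of degree [A i j]. *)
exists (fun i j x => G (ordered_pair i j) (x - A i j)); split; last first.
  move=> g; rewrite /hahn_det_coef.
  transitivity ((q 0 + q 1 * y + q 2 * y ^+ 2) (g - mu)); last by rewrite yroot.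
  have term k : (q k * y ^+ k) (g - mu) = \sum_(r : 'S_n | e r == k)
      (-1) ^+ r * (z ^+ w r * (y ^+ e r) (g - perm_value A r)).
    rewrite mulr_suml coefs_sum; apply: eq_bigr => r /eqP <-.
    by rewrite coefs_monomialM // mulrA opprB addrA subrK.
  have -> : q 0 + q 1 * y + q 2 * y ^+ 2 = \sum_(k < 3) q k * y ^+ k.
    by rewrite !big_ord_recl big_ord0 expr0 expr1 mulr1 addr0 addrA.
  (* Permutations are grouped by their exponent of [y]; [inord] loses nothing since it is at most
     2. *)
  rewrite coefs_sum (partition_big (fun r => inord (e r) : 'I_3) predT) //.
  apply: eq_bigr => k _; rewrite term; apply: eq_big => r.
    by rewrite -val_eqE /= inordK // ltnS sym_monomial_le2.
  move=> _; rewrite (coefs_prod_shift (fun i => G (ordered_pair i (r i)))) GE.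
  by rewrite coefs_monomialM // subr0.
split; [|split] => i j.
- by apply/funext => x; rewrite ordered_pairC AC.
- exact: series_shift_is_hahn.
split=> [|a aA]; first by rewrite subrr.
by rewrite coefs_lt0 // subr_lt0.
Qed.

Theorem theorem4 (n : nat) (A : 'M[RR]_n) :
  (0 < n)%N -> A^T = A ->
  (sym_trop_singular A <->
   exists M : 'I_n -> 'I_n -> RR -> CC, symmetric_lift A M /\ hahn_singular M).
Proof.
move=> _ AT; split; first exact: trop_singular_singular_lift.
by move=> [M [Mlift Msing]]; apply: singular_lift_trop_singular Mlift Msing.
Qed.
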